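(* Let $C_i,C_f$ be proper configurations of a network topology $(N,E)$ with source $H_1$. Consider the following procedure (OrderUpdate with SequentialPickAndWait). Initialize $C_c=C_i$ and empty sequences $R,R_w$. While $C_c\neq C_f$: let $U$ be the set of not-yet-updated nodes that are valid in $C_c$; if $U=\emptyset$, exit (failure); otherwise pick any $s\in U$, append $s$ to $R_w$ and to $R$ (a wait accompanies every update), replace $C_c$ by $(C_c\setminus\mathrm{out}(C_i,s))\cup\mathrm{out}(C_f,s)$, and remove $s$ from the list of nodes still to be updated. When the loop ends, return $(R,R_w)$. This procedure generates a correct order of updates $R$ (a correct sequence) if there exists one, or fails (at the exit with $U=\emptyset$) if such an order does not exist.
   Context: **Network and configurations.** A topology is a graph $(N,E)$ with $N$ a set of nodes and $E$ a set of directed edges. A configuration is a subset $C\subseteq E$. A proper configuration is one that (a) has one source $H_1$ and (b) is acyclic; here a source is a designated node with no incoming edges, representing the point where packets enter the network. Proper configurations $C_i$ (initial) and $C_f$ (final) are fixed. **Updates.** $\mathrm{out}(C,u)$ is the set of edges of $C$ whose source is $u$. $\mathrm{upd}(C,u)=(C\setminus \mathrm{out}(C_i,u))\cup \mathrm{out}(C_f,u)$; for sequences of nodes without repetition, $\mathrm{upd}(C,\varepsilon)=C$ and $\mathrm{upd}(C,uS)=\mathrm{upd}(\mathrm{upd}(C,u),S)$. **Paths.** A $C$-path is a directed path (finite or infinite) whose edges are in $C$. $\mathrm{paths}(s,t,C)$ is the set of all $C$-paths from $s$ to $t$. A $C$-path is maximal in $C$ if it is infinite, or it is finite and its last node has no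 outgoing edges in $C$; $\mathrm{maxpaths}(s,C)$ is the set of maximal paths in $C$ starting at $s$. **Consistency.** A path $p$ is consistent if $p\in\mathrm{maxpaths}(H_1,C_i)$ or $p\in\mathrm{maxpaths}(H_1,C_f)$. A configuration $C$ is consistent if every $p\in\mathrm{maxpaths}(H_1,C)$ is consistent. **Waits and consistent update sequences.** For a sequence of node updates $U=u_1u_2\cdots$, put $C_0=C_i$, $C_j=\mathrm{upd}(C_i,u_1\cdots u_j)$; for $j<l$ a wait is needed between $u_j$ and $u_l$ in $U$ iff $C_{j-1}\cup\cdots\cup C_l$ is not consistent. For a set $S$ of nodes, $\pi(S)$ is the set of sequences formed by the nodes of $S$, each used exactly once; for a sequence $Z=S_1\cdots S_k$ of subsets of $N$, $\pi(Z)=\{r_1\cdots r_k: r_j\in\pi(S_j)\}$. $Z$ is a consistent update sequence iff (1) $S_1,\dots,S_k$ partition $N$; (2) for every $U\in\pi(Z)$ and every prefix $U'$ of $U$, $\mathrm{upd}(C_i,U')$ is consistent; (3) for every $U\in\pi(Z)$ and $j<l$, if a wait is needed between $u_j$ and $u_l$ in $U$, then $u_j,u_l$ are in different sets among $S_1,\dots,S_k$. **Correct sequence.** A sequence of node updates $t_1t_2\cdots t_{|N|}$ such that the sequence of singletons $\{t_1\}\{t_2\}\cdots\{t_{|N|}\}$ is a consistent update sequence. **Valid nodes.** Given a current configuration $C_c$ and a node $s$, let $P=\mathrm{paths}(H_1,s,C_c)$ and $D=\mathrm{maxpaths}(s,\mathrm{upd}(C_c,s))$. Node $s$ is of Type A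 if $P=\emptyset$; Type B if not A and every $p\in P$ lies in both $\mathrm{paths}(H_1,s,C_i)$ and $\mathrm{paths}(H_1,s,C_f)$; Type C if not A or B and every $p\in P$ lies in $\mathrm{paths}(H_1,s,C_f)$; Type D if not A or B and every $p\in P$ lies in $\mathrm{paths}(H_1,s,C_i)$; Type E if none of A–D. Node $s$ is valid in $C_c$ if the condition for its type holds: Type A: $\mathrm{out}(C_f,s)=\emptyset$ or $D\subseteq\mathrm{maxpaths}(s,C_f)$; Type B: each $p\in D$ is in $\mathrm{maxpaths}(s,C_i)$ or in $\mathrm{maxpaths}(s,C_f)$; Type C: $D\subseteq\mathrm{maxpaths}(s,C_f)$; Type D: $D\subseteq\mathrm{maxpaths}(s,C_i)$; Type E: $D\subseteq\mathrm{maxpaths}(s,C_i)\cap\mathrm{maxpaths}(s,C_f)$.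
   Formalization: The loop may stop before all nodes are updated (e.g. C_i = C_f returns an empty R), so ''R is a correct sequence'' is read as: R has no repetitions, leads from C_i to C_f, and followed by the missing nodes in any order is a correct sequence. *)

(* Defs.v *)
From Stdlib Require Export Relation_Operators.
From mathcomp Require Export all_boot.

Set Implicit Arguments.
Unset Strict Implicit.
Unset Printing Implicit Defensive.

Section Network.

Variable N : finType.

Definition edges := {set N * N}.

Implicit Types (C E : edges) (u s t : N) (S : {set N}) (Z : seq {set N}).

Definition edge_rel C : rel N := fun u v => (u, v) \in C.

(* The source is a designated node, required to have no incoming edge; other
   nodes without incoming edges (unreachable in C) are not excluded. *)
Definition proper_config E (H1 : N) C : Prop :=
  [/\ C \subset E,
      forall u, (u, H1) \notin C
    & forall c : seq N, cycle (edge_rel C) c -> c = [::] ].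

Definition out C u : edges := [set e in C | e.1 == u].

(* A directed path, given by the nodes it visits.  FinPath x p visits x and
   then the nodes of p, so FinPath x [::] is the trivial path at x. *)
Inductive dpath : Type :=
  | FinPath of N & seq N
  | InfPath of (nat -> N).

Definition path_start (p : dpath) : N :=
  match p with FinPath x _ => x | InfPath f => f 0 end.

Definition is_path C (p : dpath) : Prop :=
  match p with
  | FinPath x q => path (edge_rel C) x q
  | InfPath f => forall k, edge_rel C (f k) (f k.+1)
  end.

Definition paths s t C (p : dpath) : Prop :=
  [/\ is_path C p, path_start p = s
    & match p with FinPath x q => last x q = t | InfPath _ => False end ].

Definition maximal C (p : dpath) : Prop :=
  match p with FinPath x q => out C (last x q) = set0 | InfPath _ => True end.

Definition maxpaths s C (p : dpath) : Prop :=
  [/\ is_path C p, path_start p = s & maximal C p].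

Definition sub_paths (A B : dpath -> Prop) : Prop := forall p, A p -> B p.

(* r lists every element of S exactly once. *)
Definition orderings S (r : seq N) : bool := perm_eq r (enum S).

Definition orderings_seq Z (U : seq N) : Prop :=
  exists2 rs : seq (seq N), all2 orderings Z rs & U = flatten rs.

Section Update.

Variables (H1 : N) (Ci Cf : edges).

Definition upd C u : edges := (C :\: out Ci u) :|: out Cf u.

Definition upd_seq C (U : seq N) : edges := foldl upd C U.

Definition consistent_path (p : dpath) : Prop :=
  maxpaths H1 Ci p \/ maxpaths H1 Cf p.

Definition consistent C : Prop :=
  forall p, maxpaths H1 C p -> consistent_path p.

(* Positions are 0-based: for j < l, the nodes at positions j and l of U are
   the (j+1)-th and (l+1)-th updates, so the union runs over the
   configurations obtained after j, j+1, ..., l+1 updates. *)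
Definition wait_needed (U : seq N) (j l : nat) : Prop :=
  ~ consistent (\bigcup_(j <= k < l.+2) upd_seq Ci (take k U)).

Definition consistent_update_sequence Z : Prop :=
  [/\ uniq Z && partition [set S in Z] [set: N],
      forall U U', orderings_seq Z U -> prefix U' U ->
        consistent (upd_seq Ci U')
    & forall U j l, orderings_seq Z U -> j < l < size U ->
        wait_needed U j l ->
        forall S, S \in Z -> ~ (nth H1 U j \in S /\ nth H1 U l \in S) ].

Definition correct_sequence (T : seq N) : Prop :=
  size T = #|N| /\ consistent_update_sequence [seq [set t] | t <- T].

(* The update loop may stop before every node has been updated, whereas a
   correct sequence lists all of them.  So R is required to lead from Ci to Cf
   (every node missing from R then has the same outgoing edges in both) and to
   be correct once followed by the missing nodes, in whatever order. *)
Definition correct_order (R : seq N) : Prop :=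
  [/\ uniq R,
      upd_seq Ci R = Cf
    & forall V, orderings (~: [set u in R]) V -> correct_sequence (R ++ V) ].

Section Validity.

Variables (Cc : edges) (s : N).

Let P := paths H1 s Cc.
Let D := maxpaths s (upd Cc s).

Definition typeA : Prop := forall p, ~ P p.

Definition typeB : Prop :=
  ~ typeA /\ forall p, P p -> paths H1 s Ci p /\ paths H1 s Cf p.

Definition typeC : Prop :=
  [/\ ~ typeA, ~ typeB & sub_paths P (paths H1 s Cf)].

Definition typeD : Prop :=
  [/\ ~ typeA, ~ typeB & sub_paths P (paths H1 s Ci)].

Definition typeE : Prop := [/\ ~ typeA, ~ typeB, ~ typeC & ~ typeD].

Definition valid : Prop :=
  [/\ typeA -> out Cf s = set0 \/ sub_paths D (maxpaths s Cf),
      typeB -> forall p, D p -> maxpaths s Ci p \/ maxpaths s Cf p,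
      typeC -> sub_paths D (maxpaths s Cf),
      typeD -> sub_paths D (maxpaths s Ci)
    & typeE -> forall p, D p -> maxpaths s Ci p /\ maxpaths s Cf p ].

End Validity.

(* Running Cc V R Rw: loop head with current configuration Cc, V the nodes
   still to be updated, R the updates so far and Rw those with a wait. *)
Inductive state : Type :=
  | Running of edges & {set N} & seq N & seq N
  | Returned of seq N & seq N
  | Failed.

Inductive step : state -> state -> Prop :=
  | step_return (V : {set N}) (R Rw : seq N) :
      step (Running Cf V R Rw) (Returned R Rw)
  | step_fail Cc (V : {set N}) (R Rw : seq N) :
      Cc <> Cf -> (forall s, s \in V -> ~ valid Cc s) ->
      step (Running Cc V R Rw) Failed
  | step_pick Cc (V : {set N}) (R Rw : seq N) s :
      Cc <> Cf -> s \in V -> valid Cc s ->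
      step (Running Cc V R Rw)
           (Running (upd Cc s) (V :\ s) (rcons R s) (rcons Rw s)).

Definition initial_state : state := Running Ci [set: N] [::] [::].

Definition reachable (o : state) : Prop :=
  clos_refl_trans state step initial_state o.

(* All executions terminate, whatever nodes are picked. *)
Definition terminates : Prop := Acc (fun o' o => step o o') initial_state.

Definition final_outcome (o : state) : Prop :=
  reachable o /\ forall o', ~ step o o'.

End Update.

End Network.

Arguments Failed {N}.

(* Main.v *)
(* Write conf W for the configuration where exactly the nodes of W are updated.
   Every update of a valid node preserves, besides consistency, the property
   "committed": below an edge of conf W that is not in Ci, everything already
   follows Cf.  Hence conf W is acyclic.  Let T be a correct sequence and
   suppose that W is not everything.  If all the nodes reachable by paths in
   conf W and Ci are in W, a node outside W all of whose proper Cf-descendants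
   are in W is valid.  Otherwise let s be the first node of T outside W reached
   by such a path, U the set of nodes before s in T.  That path survives in
   conf U, so the consistency of conf (s |: U) forces everything below the new
   edges of s to follow Cf.  If some node of U \ W is reachable in conf (s |: U)
   through a new edge of s, a lowest one for Cf is valid; otherwise s is. *)
Require Import Defs.
From mathcomp Require Import all_boot.
From Stdlib Require Import Classical_Prop.

Set Implicit Arguments.
Unset Strict Implicit.
Unset Printing Implicit Defensive.

(** * Acyclic graphs, and maximal paths reduced to finite ones *)

Section Graphs.

Variable N : finType.
Implicit Types (B C : edges N) (x y s : N) (p q : seq N).

Definition acyclic C := forall c, cycle (edge_rel C) c -> c = [::].

Lemma acyclic_uniq C x q : acyclic C -> path (edge_rel C) x q -> uniq (x :: q).
Proof.
move=> acC; elim: q x => [//|y q IH] x xyq; have /= /andP[xy yq] := xyq.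
rewrite -[_ && uniq q]/(uniq (y :: q)) (IH _ yq) andbT; apply/negP => xq.
case/splitPr: xq xyq => q1 q2; rewrite cat_path /= => /and3P[xq1 lx _].
by have := acC (x :: q1); rewrite /= rcons_path xq1 lx => /(_ isT).
Qed.

Lemma acyclic_connect_anti C x y :
  acyclic C -> connect (edge_rel C) x y -> connect (edge_rel C) y x -> x = y.
Proof.
move=> acC /connectP[p xp ->] /connectP[q yq lq].
have := acyclic_uniq acC (x := x) (q := p ++ q).
rewrite cat_path xp yq => /(_ isT).
(* If [q] is nonempty it ends at [x], so [x] occurs again in [p ++ q]. *)
case: (lastP q) lq yq => [//|q' z]; rewrite last_rcons => <- _.
by rewrite cons_uniq mem_cat mem_rcons inE eqxx orbT.
Qed.

(** Take a node of [Y] with the fewest descendants: a descendant of it in [Y] has the same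
    descendants, hence leads back to it. *)
Lemma acyclic_bottom C (Y : {set N}) x :
    acyclic C -> x \in Y ->
  exists2 y, y \in Y & forall z, z \in Y -> connect (edge_rel C) y z -> z = y.
Proof.
move=> acC xY; pose f y := #|[set z | connect (edge_rel C) y z]|.
case: (arg_minnP f xY) => y yY fmin; exists y => // z zY yz.
apply: (acyclic_connect_anti acC) => //.
have sub : [set t | connect (edge_rel C) z t] \subset
    [set t | connect (edge_rel C) y t].
  by apply/subsetP => t; rewrite !inE; apply: connect_trans yz.
have /eqP E : [set t | connect (edge_rel C) z t] ==
    [set t | connect (edge_rel C) y t].
  by rewrite eqEcard sub fmin.
have : y \in [set t | connect (edge_rel C) z t] by rewrite E inE connect0.
by rewrite inE.
Qed.

(* For a C-path, this is what being an initial part of maximal C-paths that are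
   also maximal in B amounts to; it turns statements on maxpaths, infinite paths
   included, into statements on finite paths. *)
Definition fits C B x q : bool :=
  path (edge_rel B) x q &&
  ((out C (last x q) == set0) ==> (out B (last x q) == set0)).

Lemma fits_cat C B x p q :
  fits C B x (p ++ q) = path (edge_rel B) x p && fits C B (last x p) q.
Proof. by rewrite /fits cat_path last_cat andbA. Qed.

Lemma out0P C x : reflect (forall y, ~~ edge_rel C x y) (out C x == set0).
Proof.
apply: (iffP eqP) => [E y|E].
  apply/negP => xy; have : (x, y) \in out C x by rewrite inE eqxx andbT.
  by rewrite E inE.
apply/setP => -[a b]; rewrite !inE /=; apply/negP => /andP[ab /eqP ax].
by have := E b; rewrite /edge_rel -ax ab.
Qed.

(** Extend [q] greedily by a chosen successor, either up to the first dead end or forever. *)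
Lemma maximal_extension C x q :
    path (edge_rel C) x q ->
  exists2 p, maxpaths x C p & forall B, maxpaths x B p -> fits C B x q.
Proof.
move=> xq; pose next y := odflt y [pick z | edge_rel C y z].
pose f i := iter i next (last x q).
have nextP y : out C y != set0 -> edge_rel C y (next y).
  rewrite /next; case: pickP => //= no; case/negP; apply/out0P => z.
  by rewrite no.
have fP k : (forall i, i < k -> out C (f i) != set0) ->
    path (edge_rel C) (last x q) (traject next (f 1) k)
    /\ last (last x q) (traject next (f 1) k) = f k.
  elim: k => [//|k IH] H; case: IH => [i ik|p l]; first exact/H/ltnW.
  have E : iter k next (f 1) = next (f k) by rewrite /f /= -iterSr.
  rewrite trajectSr rcons_path p l last_rcons E; split=> //=.
  exact/nextP/H.
case: (classic (exists k, out C (f k) == set0)) => [ex|nex].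
  case: (ex_minnP ex) => k k0 kmin.
  have [i ik|p l] := fP k; first by apply/negP => /kmin; rewrite leqNgt ik.
  exists (FinPath x (q ++ traject next (f 1) k)).
    by split; rewrite //= ?cat_path ?xq ?p // last_cat l; apply/eqP.
  move=> B [/= pB _ /eqP mB].
  move: pB; rewrite /fits cat_path => /andP[-> _] /=; apply/implyP => e0.
  (* If [q] already ends at a dead end of [C], minimality gives [k = 0]: nothing was appended, and
     maximality in [B] concerns the end of [q] itself. *)
  by have /eqP := kmin 0 e0; rewrite subn0 => k00; move: mB; rewrite k00 cats0.
have {}fP k := fP k (fun i _ => introN idP (fun h => nex (ex_intro _ i h))).
(* The two pieces agree at index [size q], since [f 0] is the last node of [q]. *)
pose g i := if i <= size q then nth x (x :: q) i else f (i - size q).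
have gq i : i <= size q -> g i = nth x (x :: q) i by rewrite /g => ->.
exists (InfPath g).
  split=> //= i; rewrite /g; case: (ltnP i (size q)) => iq.
    by rewrite (ltnW iq); apply: (pathP x xq).
  case: leqP => [qi|qi].
    have -> : i = size q by apply/eqP; rewrite eqn_leq iq qi.
    rewrite subSnn -[nth _ _ _]/(nth x (x :: q) (size q)) nth_last /=.
    by apply: nextP; apply/negP => h; apply: nex; exists 0.
  rewrite subSn // /f iterS; apply: nextP; apply/negP => h; apply: nex.
  by exists (i - size q).
move=> B [/= gB _ _]; apply/andP; split; last first.
  by apply/implyP => h; case: nex; exists 0.
apply/(pathP x) => i iq; have := gB i.
by rewrite !gq // ltnW.
Qed.

Lemma maxpaths_fits C B1 B2 x :
    (forall p : dpath N, maxpaths x C p -> maxpaths x B1 p \/ maxpaths x B2 p) ->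
  forall q, path (edge_rel C) x q -> fits C B1 x q || fits C B2 x q.
Proof.
move=> H q /maximal_extension[p /H[] pm fitp]; rewrite (fitp _ pm) ?orbT //.
Qed.

Lemma fits_maxpaths C B1 B2 x :
    acyclic B1 -> acyclic B2 ->
    (forall q, path (edge_rel C) x q -> fits C B1 x q || fits C B2 x q) ->
  forall p : dpath N, maxpaths x C p -> maxpaths x B1 p \/ maxpaths x B2 p.
Proof.
move=> ac1 ac2 H [y q|f] [/= pC yx mC].
  rewrite yx in pC mC *; have := H q pC; rewrite /fits mC eqxx /=.
  by case/orP => /andP[? /eqP ?]; [left|right].
(* An infinite path is impossible: its first [#|N|] edges would form a path of [B1] or [B2], whose
   [#|N| + 1] nodes are distinct by acyclicity. *)
pose q := mkseq (fun i => f i.+1) #|N|.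
have fE i : i <= #|N| -> nth x (x :: q) i = f i.
  by case: i => [//|i iN]; rewrite /= nth_mkseq.
have xq : path (edge_rel C) x q.
  apply/(pathP x) => i; rewrite size_mkseq => iN.
  by rewrite -[nth x q i]/(nth x (x :: q) i.+1) !fE // ltnW.
have : uniq (x :: q).
  by have /orP[] := H q xq => /andP[pB _]; apply: acyclic_uniq pB.
move/card_uniqP => E; have := max_card [in x :: q].
by rewrite E /= size_mkseq ltnn.
Qed.

End Graphs.

(** * Configurations given by the set of updated nodes *)

Section Configurations.

Variables (N : finType) (H1 : N) (Ci Cf : edges N).
Hypotheses (acCi : acyclic Ci) (acCf : acyclic Cf).
Implicit Types (u v w x y z s : N) (p q : seq N) (U V W : {set N}).

Definition conf W : edges N :=
  [set e | if e.1 \in W then e \in Cf else e \in Ci].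

Local Notation rel W := (edge_rel (conf W)).

Lemma conf_in W u v : u \in W -> rel W u v = edge_rel Cf u v.
Proof. by rewrite /edge_rel inE /= => ->. Qed.

Lemma conf_notin W u v : u \notin W -> rel W u v = edge_rel Ci u v.
Proof. by rewrite /edge_rel inE /= => /negbTE->. Qed.

Lemma conf_eq U V u v : (u \in U) = (u \in V) -> rel U u v = rel V u v.
Proof. by rewrite /edge_rel !inE /= => ->. Qed.

Lemma out_eq (C C' : edges N) u :
  (forall v, edge_rel C u v = edge_rel C' u v) -> out C u = out C' u.
Proof.
move=> H; apply/setP => -[a b]; rewrite !inE /=.
by case: eqP => [->|_]; rewrite ?andbF //; have := H b; rewrite /edge_rel => ->.
Qed.

Lemma upd_conf W u : upd Ci Cf (conf W) u = conf (u |: W).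
Proof.
apply/setP => -[a b]; rewrite !inE /=.
by case: eqP => _; case: (a \in W); case: (_ \in Ci); case: (_ \in Cf).
Qed.

Lemma upd_seq_conf (R : seq N) : upd_seq Ci Cf Ci R = conf [set u in R].
Proof.
elim/last_ind: R => [|R u IH].
  by apply/setP => e; rewrite !inE in_nil.
rewrite /upd_seq foldl_rcons -/(upd_seq _ _ _ _) IH upd_conf; congr conf.
by apply/setP => v; rewrite !inE mem_rcons inE.
Qed.

(** * Consistency and settled nodes in terms of finite paths *)

Definition consist W : Prop :=
  forall q, path (rel W) H1 q ->
    fits (conf W) Ci H1 q || fits (conf W) Cf H1 q.

Lemma consistP W : consistent H1 Ci Cf (conf W) <-> consist W.
Proof.
split=> [cW q|cW p]; first exact: maxpaths_fits.
exact: fits_maxpaths.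
Qed.

Lemma consist_path W q :
  consist W -> path (rel W) H1 q ->
  path (edge_rel Ci) H1 q || path (edge_rel Cf) H1 q.
Proof. by move=> cW /cW /orP[] /andP[-> _]; rewrite ?orbT. Qed.

(** The local form of [fits] into [Cf]. It is an inclusion, since a node not yet updated may have
    only some of its [Cf] edges; the second clause forbids stopping where [Cf] goes on. *)
Definition settled W x : bool :=
  (out (conf W) x \subset out Cf x) &&
  ((out (conf W) x == set0) ==> (out Cf x == set0)).

Lemma settled_in W x : x \in W -> settled W x.
Proof.
move=> xW; have E : out (conf W) x = out Cf x.
  by apply: out_eq => v; rewrite conf_in.
by rewrite /settled E subxx implybb.
Qed.

Lemma settled_edge W x y : settled W x -> rel W x y -> edge_rel Cf x y.
Proof.
case/andP => /subsetP sub _ xy; have := sub (x, y).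
by move: xy; rewrite /edge_rel !inE eqxx !andbT => xy; apply.
Qed.

Lemma settled_imp U W x : (x \in U -> x \in W) -> settled U x -> settled W x.
Proof.
move=> UW sx; case: (boolP (x \in W)) => [|xW]; first exact: settled_in.
have E : out (conf W) x = out (conf U) x.
  by apply: out_eq => v; apply: conf_eq; rewrite (negbTE xW) (contraNF UW).
by rewrite /settled E.
Qed.

Definition settled_below W x : Prop :=
  forall z, connect (rel W) x z -> settled W z.

Lemma settled_belowP W x :
  (forall q, path (rel W) x q -> fits (conf W) Cf x q) <-> settled_below W x.
Proof.
split=> [H z /connectP[q xq ->]|H q xq].
  have /andP[_ end0] := H q xq; rewrite /settled end0 andbT.
  apply/subsetP => -[a b]; rewrite [(a, b) \in out (conf W) _]inE /=.
  (* Lengthening [q] by one edge shows that this edge is in [Cf]. *)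
  case/andP => ab /eqP ax; have := H (rcons q b).
  rewrite /fits !rcons_path xq /edge_rel -ax ab inE eqxx andbT.
  by case/(_ isT)/andP => /andP[_ ->].
have /andP[_ end0] : settled W (last x q).
  by apply: H; apply/connectP; exists q.
rewrite /fits end0 andbT; elim: q x xq H {end0} => //= y q IH x /andP[xy yq] H.
rewrite (settled_edge (H x _) xy) ?connect0 //=; apply: IH => // z yz.
exact/H/(connect_trans (connect1 xy)).
Qed.

Lemma settled_below_connect W x y :
  settled_below W x -> connect (rel W) x y -> connect (edge_rel Cf) x y.
Proof.
move/settled_belowP => H /connectP[q xq ->].
by have /andP[xq' _] := H q xq; apply/connectP; exists q.
Qed.

(** * Fresh edges and committed configurations *)

Definition fresh W u v : bool := rel W u v && ~~ edge_rel Ci u v.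

Definition committed W : Prop := forall u v, fresh W u v -> settled_below W v.

Definition good W : Prop := consist W /\ committed W.

(** A cycle with a fresh edge lies entirely below that edge, hence in [Cf]; a cycle without one lies
    in [Ci]. *)
Lemma committed_acyclic W : committed W -> acyclic (conf W).
Proof.
move=> cW c cyc; case: (boolP [exists u in c, exists v in c, fresh W u v]).
  case/exists_inP => u uc /exists_inP[v vc uv]; apply: acCf.
  apply: (sub_in_cycle (P := [in c])) (cyc); last exact/allP.
  move=> a b ac bc ab; apply: settled_edge ab; apply: cW uv _ _.
  exact: (connect_cycle cyc vc ac).
move=> /exists_inPn H; apply: acCi.
apply: (sub_in_cycle (P := [in c])) (cyc); last exact/allP.
move=> a b ac bc ab; have /exists_inPn/(_ b bc) := H a ac.
by rewrite /fresh ab negbK.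
Qed.

Lemma good0 : good set0.
Proof.
have E u v : rel set0 u v = edge_rel Ci u v by rewrite conf_notin ?inE.
split=> [q|u v]; last by rewrite /fresh E andbN.
rewrite (eq_path E) => pq; apply/orP; left.
by rewrite /fits pq (out_eq (E _)) implybb.
Qed.

(** * The effect of one update on paths *)

Lemma rel_setU1 W s x y : x != s -> rel (s |: W) x y = rel W x y.
Proof. by move=> xs; apply: conf_eq; rewrite !inE (negbTE xs). Qed.

(** The path is cut at its first visit to [s]; before that, the update is invisible. *)
Lemma path_setU1 W s x q :
    path (rel (s |: W)) x q ->
  path (rel W) x q /\ last x q != s \/
  exists p r, [/\ q = p ++ r, path (rel W) x p, last x p = s
                & path (rel (s |: W)) s r].
Proof.
elim: q x => [|y q IH] x /=.
  by case: (eqVneq x s) => [xs|]; [right; exists [::], [::]|left].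
case/andP => xy yq; case: (eqVneq x s) => [xs|xs].
  by rewrite xs in xy *; right; exists [::], (y :: q); rewrite /= xy.
move: xy; rewrite rel_setU1 // => xy.
case: (IH y yq) => [[? ?]|[p [r [-> yp ls sr]]]]; first by left; rewrite xy.
by right; exists (y :: p), r; rewrite /= xy.
Qed.

Lemma path_avoid W s x q : s \notin belast x q ->
  path (rel (s |: W)) x q = path (rel W) x q.
Proof.
elim: q x => //= y q IH x; rewrite inE negb_or eq_sym => /andP[xs /IH->].
by rewrite rel_setU1.
Qed.

Lemma uniq_last_belast x q : uniq (x :: q) -> last x q \notin belast x q.
Proof. by rewrite lastI rcons_uniq => /andP[]. Qed.

(* Once past a fresh edge, every continuation follows Cf; so the only new
   obligation concerns the edges that the update of s introduces. *)
Lemma committed_setU1 W s :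
    committed W ->
    (forall w, edge_rel Cf s w -> ~~ edge_rel Ci s w ->
       settled_below (s |: W) w) ->
  committed (s |: W).
Proof.
move=> cW Hs u v; case: (eqVneq u s) => [->|us].
  by rewrite /fresh conf_in ?setU11 // => /andP[]; apply: Hs.
rewrite /fresh rel_setU1 // => uv z /connectP[q vq ->].
(* Either the end is already below [v] in [conf W], or the walk has used an edge introduced by the
   update of [s]. *)
suff: connect (rel W) v (last v q) \/ exists2 w,
    edge_rel Cf s w && ~~ edge_rel Ci s w & connect (rel (s |: W)) w (last v q).
  case=> [vz|[w /andP[sw sw'] wz]]; last exact: Hs wz.
  by apply: settled_imp (cW _ _ uv _ vz); rewrite inE => ->; rewrite orbT.
elim/last_ind: q vq => [|q z' IH]; first by left; apply: connect0.
rewrite rcons_path last_rcons => /andP[/IH{}IH yz].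
case: IH => [vy|[w sw wy]]; last first.
  by right; exists w => //; apply: connect_trans wy (connect1 yz).
case: (eqVneq (last v q) s) => ys; last first.
  by left; apply: connect_trans vy (connect1 _); rewrite -(rel_setU1 _ _ ys).
move: yz vy; rewrite ys conf_in ?setU11 // => sz vs.
case: (boolP (edge_rel Ci s z')) => [sz'|sz']; last first.
  by right; exists z'; rewrite ?sz ?connect0.
(* This edge is in both [Ci] and [Cf], so it is in [conf W] whether or not [s] is updated. *)
case: (boolP (s \in W)) => sW; left; apply: connect_trans vs (connect1 _).
  by rewrite conf_in.
by rewrite conf_notin.
Qed.

(** * Updates of valid nodes preserve goodness *)

Lemma pathsE C s p :
  paths H1 s C (FinPath H1 p) <-> path (edge_rel C) H1 p /\ last H1 p = s.
Proof. by split=> [[]|[]]. Qed.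

Lemma pathsP C s (P : dpath N) : paths H1 s C P ->
  exists p, [/\ P = FinPath H1 p, path (edge_rel C) H1 p & last H1 p = s].
Proof. by case: P => [x p|f] [] //= + <- <-; exists p. Qed.

(** The type of [s] tells which of [Ci] and [Cf] the paths into [s] follow, and validity makes the
    continuations match. The first conjunct does not mention these paths, so that it still says
    something when there are none. *)
Lemma valid_fits W s :
    consist W -> valid H1 Ci Cf (conf W) s ->
  forall q, path (rel (s |: W)) s q ->
    (fits (conf (s |: W)) Ci s q || fits (conf (s |: W)) Cf s q) /\
    forall p, path (rel W) H1 p -> last H1 p = s ->
      fits (conf (s |: W)) Ci H1 (p ++ q) ||
      fits (conf (s |: W)) Cf H1 (p ++ q).
Proof.
move=> cW; rewrite /valid upd_conf; set C' := conf (s |: W) => -[vA vB vC vD vE] q sq.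
have sub B : sub_paths (maxpaths s C') (maxpaths s B) -> fits C' B s q.
  by move=> H; rewrite -[fits _ _ _ _]orbb; apply: maxpaths_fits sq => P /H; left.
case: (classic (typeA H1 (conf W) s)) => [tA|nA].
  split; last by move=> p Wp lp; case: (tA (FinPath H1 p)); apply/pathsE.
  apply/orP; right; case: (vA tA) => [out0|/sub //].
  (* If [s] has no [Cf] edge, it is a dead end after its update and [q] is empty. *)
  case: q sq {sub} => [|y q] /=; first by rewrite /fits /= out0 eqxx implybT.
  rewrite conf_in ?setU11 // => /andP[sy _].
  by move/eqP/out0P: out0 => /(_ y); rewrite sy.
case: (classic (typeB H1 Ci Cf (conf W) s)) => [tB|nB].
  have Dq := maxpaths_fits (vB tB) sq; split=> // p Wp lp.
  case: tB => _ /(_ (FinPath H1 p)); rewrite !pathsE.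
  case/(_ (conj Wp lp)) => [[pi _][pf _]].
  by rewrite !fits_cat pi pf lp.
case: (classic (typeC H1 Ci Cf (conf W) s)) => [tC|nC].
  have Dq := sub _ (vC tC); split; first by rewrite Dq orbT.
  move=> p Wp lp; case: tC => _ _ /(_ (FinPath H1 p)); rewrite !pathsE.
  case/(_ (conj Wp lp)) => pf _.
  by rewrite !fits_cat pf lp Dq orbT.
case: (classic (typeD H1 Ci Cf (conf W) s)) => [tD|nD].
  have Dq := sub _ (vD tD); split; first by rewrite Dq.
  move=> p Wp lp; case: tD => _ _ /(_ (FinPath H1 p)); rewrite !pathsE.
  case/(_ (conj Wp lp)) => pf _.
  by rewrite !fits_cat pf lp Dq.
(* Type E: the continuation fits both configurations, so it suffices that [p] follows one of
   them. *)
have D P : maxpaths s C' P -> maxpaths s Ci P /\ maxpaths s Cf P by apply: vE.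
have Di : fits C' Ci s q by apply: sub => P /D[].
have Df : fits C' Cf s q by apply: sub => P /D[].
rewrite Di; split=> // p Wp lp; rewrite !fits_cat lp Di Df !andbT.
exact: consist_path cW Wp.
Qed.

Lemma consist_setU1 W s :
    consist W ->
    (forall p q, path (rel W) H1 p -> last H1 p = s -> path (rel (s |: W)) s q ->
      fits (conf (s |: W)) Ci H1 (p ++ q) ||
      fits (conf (s |: W)) Cf H1 (p ++ q)) ->
  consist (s |: W).
Proof.
move=> cW H q /path_setU1[[Wq lq]|[p [r [-> Wp lp sr]]]]; last exact: H.
have := cW q Wq; rewrite /fits (out_eq (C' := conf (s |: W))) // => v.
by rewrite rel_setU1.
Qed.

Lemma valid_good W s :
  good W -> valid H1 Ci Cf (conf W) s -> good (s |: W).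
Proof.
move=> [cW jW] vs; have D := valid_fits cW vs; split.
  by apply: consist_setU1 => // p q Wp lp /D[_]; apply.
apply: committed_setU1 => // w sw sw'; apply/settled_belowP => q wq.
(* The path [w :: q] starts with an edge outside [Ci], so it can only fit [Cf]. *)
have [|+ _] := D (w :: q); first by rewrite /= conf_in ?setU11 // sw.
by rewrite -[w :: q]/([:: w] ++ q) !fits_cat /= (negbTE sw') sw.
Qed.

(** * Criteria for validity *)

Lemma path_setU1_last W s p :
    consist W -> path (rel W) H1 p -> last H1 p = s ->
  path (rel (s |: W)) H1 p.
Proof.
move=> cW Wp lp; rewrite path_avoid //.
(* By consistency [p] is a path of an acyclic graph, so it meets [s] only at its end and uses no
   edge leaving [s]. *)
rewrite -lp; apply: uniq_last_belast.
by case/orP: (consist_path cW Wp); apply: acyclic_uniq.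
Qed.

(** Any path [p] into [s] and continuation [q] jointly follow [Ci] or jointly follow [Cf]. Hence one
    [p] outside [Cf] forces every [q] to fit [Ci], and symmetrically; the definitions of types C, D
    and E supply such a [p]. *)
Lemma reachable_valid W s p0 :
    consist W -> consist (s |: W) -> path (rel W) H1 p0 -> last H1 p0 = s ->
  valid H1 Ci Cf (conf W) s.
Proof.
move=> cW cW' Wp0 lp0.
rewrite /valid upd_conf; set C' := conf (s |: W).
have key p q : path (rel W) H1 p -> last H1 p = s -> path (edge_rel C') s q ->
    path (edge_rel Ci) H1 p && fits C' Ci s q
    || path (edge_rel Cf) H1 p && fits C' Cf s q.
  move=> Wp lp sq; have := cW' (p ++ q).
  by rewrite cat_path (path_setU1_last cW) // lp !fits_cat lp => /(_ sq).
have max1 B : acyclic B -> (forall q, path (edge_rel C') s q -> fits C' B s q) ->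
    sub_paths (maxpaths s C') (maxpaths s B).
  move=> acB H P DP; suff [] : maxpaths s B P \/ maxpaths s B P by [].
  by apply: fits_maxpaths DP => // q /H->.
have fitsi : ~ sub_paths (paths H1 s (conf W)) (paths H1 s Cf) ->
    forall q, path (edge_rel C') s q -> fits C' Ci s q.
  move=> nCf q sq; apply: contraT => ni; case: nCf => P /pathsP[p [-> Wp lp]].
  by apply/pathsE; have := key p q Wp lp sq; rewrite (negbTE ni) andbF => /andP[].
have fitsf : ~ sub_paths (paths H1 s (conf W)) (paths H1 s Ci) ->
    forall q, path (edge_rel C') s q -> fits C' Cf s q.
  move=> nCi q sq; apply: contraT => nf; case: nCi => P /pathsP[p [-> Wp lp]].
  by apply/pathsE; have := key p q Wp lp sq; rewrite (negbTE nf) andbF orbF => /andP[].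
split.
- by move=> /(_ (FinPath H1 p0)) []; apply/pathsE.
- move=> _; apply: fits_maxpaths => // q sq.
  by case/orP: (key p0 q Wp0 lp0 sq) => /andP[_ ->]; rewrite ?orbT.
- case=> nA nB subf; apply/max1/fitsf => // subi; apply: nB; split=> // P PP.
  by split; [apply: subi|apply: subf].
- case=> nA nB subi; apply/max1/fitsi => // subf; apply: nB; split=> // P PP.
  by split; [apply: subi|apply: subf].
case=> nA nB nC nD P DP; split.
  by apply: (max1 _ acCi) DP; apply: fitsi => subf; apply: nC.
by apply: (max1 _ acCf) DP; apply: fitsf => subi; apply: nD.
Qed.

(** All paths into [s] follow [Cf], which leaves only types A, B and C, and their conditions are met
    by continuations following [Cf]. *)
Lemma settled_below_valid W s :
    (forall p, path (rel W) H1 p -> last H1 p = s -> path (edge_rel Cf) H1 p) ->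
    settled_below (s |: W) s ->
  valid H1 Ci Cf (conf W) s.
Proof.
move=> Pf /settled_belowP Df; rewrite /valid upd_conf; set C' := conf (s |: W).
have subP : sub_paths (paths H1 s (conf W)) (paths H1 s Cf).
  by move=> P /pathsP[p [-> Wp lp]]; apply/pathsE; split=> //; apply: Pf.
have subD : sub_paths (maxpaths s C') (maxpaths s Cf).
  move=> P DP; suff [] : maxpaths s Cf P \/ maxpaths s Cf P by [].
  by apply: fits_maxpaths DP => // q /Df->.
split=> [_|_ P /subD|_|[nA nB subi]|[nA nB nC _]]; [by right|by right|by []| |].
  by case: nB; split=> // P PP; split; [apply: subi|apply: subP].
by case: nC; split.
Qed.

(** * Paths common to the current configuration and [Ci] *)

Lemma connect_preserved (e : ssrbool.rel N) (Q : N -> Prop) x y :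
  Q x -> (forall u v, Q u -> e u v -> Q v) -> connect e x y -> Q y.
Proof.
move=> Qx Qe /connectP[p xp ->]; elim: p x Qx xp => //= u p IH x Qx /andP[xu].
by apply: IH; apply: Qe xu.
Qed.

Definition unchanged W : ssrbool.rel N := 
  [rel u v | rel W u v && edge_rel Ci u v].

Lemma unchanged_path W p : path (unchanged W) H1 p ->
  path (rel W) H1 p /\ path (edge_rel Ci) H1 p.
Proof. by rewrite path_relI => /andP[]. Qed.

(** At a node outside [U] the edge is available as a [Ci] edge; a node of [U] on the path must be in
    [W], so its edge is a [Cf] edge. *)
Lemma unchanged_path_transfer W U p :
    (forall u, u \in U -> u \notin W -> ~~ connect (unchanged W) H1 u) ->
    path (unchanged W) H1 p ->
  path (rel U) H1 p.
Proof.
move=> H; suff: forall x, connect (unchanged W) H1 x ->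
    path (unchanged W) x p -> path (rel U) x p.
  by apply; apply: connect0.
elim: p => //= y p IH x Hx /andP[xy yp].
rewrite IH ?andbT //; last exact: connect_trans Hx (connect1 xy).
case/andP: xy => xy iy; case: (boolP (x \in U)) => xU; last by rewrite conf_notin.
rewrite conf_in // -(conf_in (W := W)) //.
by apply: contraTT Hx; apply: H.
Qed.

(** By consistency a path into [x] follows [Ci] or [Cf], and the first would make it an unchanged
    path. *)
Lemma valid_of_unreached W x :
    consist W -> x \notin W -> ~~ connect (unchanged W) H1 x ->
    settled_below (x |: W) x ->
  valid H1 Ci Cf (conf W) x.
Proof.
move=> cW xW nx; apply: settled_below_valid => p Wp lp.
case/orP: (consist_path cW Wp) => // ip; case/negP: nx.
by apply/connectP; exists p; rewrite // path_relI Wp.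
Qed.

Lemma exists_valid_covered W x0 :
    consist W -> x0 \notin W ->
    (forall u, connect (unchanged W) H1 u -> u \in W) ->
  exists2 x, x \notin W & valid H1 Ci Cf (conf W) x.
Proof.
move=> cW x0W cov; have [|x] := acyclic_bottom (Y := ~: W) (x := x0) acCf.
  by rewrite inE.
rewrite inE => xW bot; exists x => //; apply: valid_of_unreached => //.
  by apply: contra xW; apply: cov.
have inW z : connect (edge_rel Cf) x z -> z \in x |: W.
  rewrite !inE => xz; case: (boolP (z \in W)) => zW; rewrite ?orbT //.
  by rewrite (bot z) ?inE ?eqxx.
(* A walk from [x] meets only updated nodes, so it stays among the [Cf]-descendants of [x]. *)
move=> z xz; apply/settled_in/inW.
apply: (connect_preserved (Q := connect (edge_rel Cf) x)) xz => [|u v xu uv];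
  first exact: connect0.
apply: connect_trans (xu) (connect1 _).
by rewrite -(conf_in _ (inW u xu)).
Qed.

(** * The next missing update of a correct sequence *)

Section NextUpdate.

Variables (W U : {set N}) (s : N).
Hypotheses (gW : good W) (cU : consist (s |: U)) (sW : s \notin W).
Hypothesis reach_s : connect (unchanged W) H1 s.
Hypothesis unreachU :
  forall u, u \in U -> u \notin W -> ~~ connect (unchanged W) H1 u.

Definition newly w : bool := edge_rel Cf s w && ~~ edge_rel Ci s w.

Lemma unchanged_path_U p : path (unchanged W) H1 p -> last H1 p = s ->
  path (rel (s |: U)) H1 p.
Proof.
move=> Wp lp; have Up := unchanged_path_transfer unreachU Wp.
have [_ ip] := unchanged_path Wp.
by rewrite path_avoid // -lp; apply/uniq_last_belast/(acyclic_uniq acCi ip).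
Qed.

(** The path [p] survives in [conf (s |: U)]. Prolonged by the edge from [s] to [w], which is not in
    [Ci], it must follow [Cf] throughout. *)
Lemma newly_fits p w q :
    path (unchanged W) H1 p -> last H1 p = s -> newly w ->
    path (rel (s |: U)) w q ->
  path (edge_rel Cf) H1 p && fits (conf (s |: U)) Cf w q.
Proof.
move=> Wp lp /andP[sw sw'] wq; have := cU (q := p ++ [:: w] ++ q).
rewrite cat_path unchanged_path_U //= lp conf_in ?setU11 // sw wq => /(_ isT).
by rewrite -[w :: q]/([:: w] ++ q) !fits_cat /= lp (negbTE sw') sw andbF.
Qed.

Lemma newly_settled w : newly w -> settled_below (s |: U) w.
Proof.
move=> nw; case/connectP: reach_s => p Wp lp; apply/settled_belowP => q wq.
by case/andP: (newly_fits Wp (esym lp) nw wq).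
Qed.

(** A return to [s] would follow [Cf] and close a cycle of [Cf] with the edge from [s] to [w]. *)
Lemma newly_not_back w : newly w -> ~~ connect (rel (s |: U)) w s.
Proof.
move=> nw; apply/negP => ws.
have ws' := settled_below_connect (newly_settled nw) ws.
case/andP: nw => sw _; case/connectP: ws' => q wq ls.
have /= := acyclic_uniq acCf (x := s) (q := w :: q).
by rewrite sw wq => /(_ isT); rewrite {1}ls mem_last.
Qed.

Definition exposed y : bool := [exists w, newly w && connect (rel (s |: U)) w y].

Lemma exposed_settled y : exposed y -> settled (s |: U) y.
Proof. by case/existsP => w /andP[/newly_settled + wy]; apply. Qed.

Lemma exposed_edge y z : exposed y -> rel (s |: U) y z -> exposed z.
Proof.
case/existsP => w /andP[nw wy] yz; apply/existsP; exists w; rewrite nw.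
exact: connect_trans wy (connect1 yz).
Qed.

Lemma newly_exposed w : newly w -> exposed w.
Proof. by move=> nw; apply/existsP; exists w; rewrite nw connect0. Qed.

Lemma exposed_neq y : exposed y -> y != s.
Proof.
by case/existsP => w /andP[nw wy]; apply: contraTneq wy => ->; apply: newly_not_back.
Qed.

(* A path leaving s by a new edge stays among the exposed nodes until it meets
   a fresh edge of conf W, after which committed W takes over. *)
Lemma exposed_settled_below x w :
    x \notin W -> (x == s) || exposed x && (x \in U) ->
    (forall y, y \in U -> exposed y -> connect (edge_rel Cf) x y -> y \in x |: W) ->
    exposed w -> connect (edge_rel Cf) x w ->
  settled_below (x |: W) w.
Proof.
move=> xW xs UW ew xw z.
pose Q z := exposed z /\ connect (edge_rel Cf) x z
  \/ exists u v, fresh W u v /\ connect (rel W) v z.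
have Qfresh v : edge_rel Cf x v -> exposed v -> Q v.
  by move=> xv ev; left; split; rewrite // connect1.
move=> wz; have {wz} : Q z.
  apply: (connect_preserved (Q := Q)) wz => [|u v]; first by left.
  case: (eqVneq u x) => [->|ux] Qu.
    rewrite conf_in ?setU11 // => xv.
    case/orP: xs => [/eqP xs|/andP[ex xU]]; last first.
      apply: Qfresh => //; apply: exposed_edge ex _.
      by rewrite conf_in // inE xU orbT.
    (* Here [x] is [s], which is not exposed, so the walk is already below a fresh edge. A [Ci] edge
       of [s] keeps it there in [conf W]; a new one leads to an exposed node. *)
    case: Qu => [[/exposed_neq]|[a [b [ab bx]]]]; first by rewrite xs eqxx.
    case: (boolP (edge_rel Ci x v)) => iv.
      right; exists a, b; split=> //; apply: connect_trans bx (connect1 _).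
      by rewrite conf_notin.
    by apply: Qfresh => //; apply: newly_exposed; rewrite /newly -xs xv iv.
  rewrite rel_setU1 // => uv; case: Qu => [[eu xu]|[a [b [ab bu]]]]; last first.
    by right; exists a, b; split=> //; apply: connect_trans bu (connect1 uv).
  (* For [u] in [U], [UW] gives [u] in [W], so [conf W] and [conf (s |: U)] agree at [u]. Otherwise
     a [Ci] edge of [u] is still in [conf (s |: U)], and any other edge is fresh. *)
  case: (boolP (u \in U)) => uU.
    have := UW u uU eu xu; rewrite !inE (negbTE ux) /= => uW.
    rewrite conf_in // in uv; left; split; last exact: connect_trans xu (connect1 uv).
    by apply: exposed_edge eu _; rewrite conf_in // inE uU orbT.
  case: (boolP (edge_rel Ci u v)) => iv; last first.
    by right; exists u, v; rewrite /fresh uv iv connect0.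
  have uv' : rel (s |: U) u v.
    by rewrite conf_notin // !inE negb_or uU (exposed_neq eu).
  left; split; first exact: exposed_edge uv'.
  exact: connect_trans xu (connect1 (settled_edge (exposed_settled eu) uv')).
case=> [[ez xz]|[a [b [ab bz]]]].
  apply: settled_imp (exposed_settled ez).
  rewrite inE in_set1 (negbTE (exposed_neq ez)) /=.
  by move=> zU; apply: UW.
by apply: settled_imp (gW.2 _ _ ab _ bz); rewrite inE => ->; rewrite orbT.
Qed.

Lemma next_good :
  (forall y, y \in U -> exposed y -> y \in W) -> good (s |: W).
Proof.
move=> UW; have [cW jW] := gW.
have below w : newly w -> settled_below (s |: W) w.
  move=> nw; apply: exposed_settled_below => //; first by rewrite eqxx.
  - by move=> y yU ey _; rewrite inE UW ?orbT.
  - exact: newly_exposed.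
  by apply: connect1; case/andP: nw.
have jW' : committed (s |: W).
  by apply: committed_setU1 => // w sw sw'; apply: below; rewrite /newly sw.
split=> //; apply: consist_setU1 => // p [|w q] Wp lp.
  (* The path stops at [s]. If it follows [Ci], it survives in [conf (s |: U)], where [s] has the
     same outgoing edges, and [cU] applies. *)
  move=> _; rewrite cats0; case/orP: (consist_path cW Wp) => pB; last first.
    by rewrite /fits pB lp; case/andP: (settled_in (setU11 s W)) => _ ->; rewrite orbT.
  have Up : path (unchanged W) H1 p by rewrite path_relI Wp.
  have := cU (unchanged_path_U Up lp).
  rewrite /fits lp (out_eq (C := conf (s |: U)) (C' := conf (s |: W))) // => v.
  by rewrite !conf_in ?setU11.
case: (boolP (edge_rel Ci s w)) => iw swq; last first.
  have nw : newly w by move: swq; rewrite /= conf_in ?setU11 // /newly iw => /andP[->].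
  have /andP[sw wq] := swq.
  (* After a new edge everything follows [Cf]; [newly_fits] with an empty continuation shows that
     [p] does too, even when it is a [Ci] path. *)
  have fq := (settled_belowP _ _).2 (below w nw) q wq.
  rewrite -[w :: q]/([:: w] ++ q) !fits_cat /= fq lp.
  have -> : edge_rel Cf s w by case/andP: nw.
  rewrite !andbT; apply/orP; right.
  case/orP: (consist_path cW Wp) => // pB.
  have Up : path (unchanged W) H1 p by rewrite path_relI Wp.
  by case/andP: (newly_fits Up lp nw (q := [::]) isT).
(* The first edge after [s] is a [Ci] edge. By acyclicity the path never returns to [s], so it is a
   path of [conf W], already known to be consistent. *)
have := acyclic_uniq (committed_acyclic jW') swq; rewrite cons_uniq => /andP[sq _].
have Wpq : path (rel W) H1 (p ++ w :: q).
  rewrite cat_path Wp lp /= conf_notin // iw -(@path_avoid W s).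
    by case/andP: swq.
  by apply: contra sq => /mem_belast.
have := cW _ Wpq; rewrite /fits (out_eq (C := conf W) (C' := conf (s |: W))) // => v.
rewrite rel_setU1 // last_cat lp /=.
by apply: contraNneq sq => <-; apply: mem_last.
Qed.

Lemma exists_valid_next : exists2 x, x \notin W & valid H1 Ci Cf (conf W) x.
Proof.
have [cW jW] := gW; pose Y := [set y in U | (y \notin W) && exposed y].
have [Y0|[y0 y0Y]] := set_0Vmem Y.
  have [cW' _] : good (s |: W).
    apply: next_good => y yU ey; apply: contraT => yW.
    have : y \in Y by rewrite inE yU yW.
    by rewrite Y0 inE.
  have [p Wp lp] := connectP reach_s; exists s => //.
  by apply: reachable_valid (esym lp) => //; case: (unchanged_path Wp).
have [y + bot] := acyclic_bottom acCf y0Y.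
rewrite inE => /and3P[yU yW ey]; exists y => //; apply: valid_of_unreached => //.
  exact: unreachU.
apply: exposed_settled_below => //; first by rewrite ey yU orbT.
move=> z zU ez yz; rewrite !inE; case: (boolP (z \in W)) => zW; first by rewrite orbT.
by rewrite (bot z) ?inE ?zU ?zW // eqxx.
Qed.

End NextUpdate.

(** * Existence of a valid node *)

Lemma exists_valid W (T : seq N) :
    good W -> (forall u, u \in T) -> uniq T ->
    (forall k, consist [set u in take k T]) -> W != [set: N] ->
  exists2 x, x \notin W & valid H1 Ci Cf (conf W) x.
Proof.
move=> gW allT uT cT WT.
pose A := [pred u | (u \notin W) && connect (unchanged W) H1 u].
case: (pickP A) => [s0 s0A|noA]; last first.
  have [x0 x0W] : exists x0, x0 \notin W.
    apply/existsP; apply: contraNT WT => /existsPn H.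
    by rewrite eqEsubset subsetT; apply/subsetP => u _; have := H u; rewrite negbK.
  apply: exists_valid_covered gW.1 x0W _ => u Hu.
  by apply: contraFT (noA u) => uW; rewrite /= uW.
case: (arg_minnP (fun u => index u T) s0A) => s /andP[sW reach_s] smin.
pose U := [set u in take (index s T) T].
have ltU u : u \in U -> index u T < index s T by rewrite inE => /index_ltn.
apply: (@exists_valid_next W U s) => //.
  (* [s |: U] is the set of nodes of the prefix of [T] that ends with [s]. *)
  have -> : s |: U = [set u in take (index s T).+1 T]; last exact: cT.
  apply/setP => u; rewrite (take_nth s) ?index_mem // nth_index //.
  by rewrite !inE mem_rcons inE.
move=> u /ltU us uW; apply/negP => Hu.
by have := smin u; rewrite /= uW Hu leqNgt us => /(_ isT).
Qed.

(** * Correct sequences and consistency of prefixes *)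

Lemma orderings_seq_set1 (T U : seq N) :
  orderings_seq [seq [set t] | t <- T] U <-> U = T.
Proof.
split=> [[rs]|->].
  elim: T rs U => [|t T IH] [|r rs] U //= /andP[rt /IH{}IH] ->.
  move: rt; rewrite /orderings enum_set1 => /(@perm_small_eq _ _ [:: t] isT)->.
  by rewrite /= (IH (flatten rs)).
exists [seq [:: t] | t <- T]; last by elim: T => //= t T <-.
by elim: T => //= t T ->; rewrite /orderings enum_set1 perm_refl.
Qed.

Lemma partition_set1 (T : seq N) :
  (forall u, u \in T) -> partition [set S in [seq [set t] | t <- T]] [set: N].
Proof.
move=> allT; apply/and3P; split.
- rewrite eqEsubset subsetT; apply/subsetP => u _; apply/bigcupP.
  by exists [set u]; rewrite ?inE // map_f.
- apply/trivIsetP => A B; rewrite !inE => /mapP[a _ ->] /mapP[b _ ->] ab.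
  by rewrite disjoints1 inE; apply: contraNneq ab => ->.
by rewrite inE; apply/mapP => -[t _ /setP/(_ t)]; rewrite !inE eqxx.
Qed.

Lemma mem_full_uniq (T : seq N) u : size T = #|N| -> uniq T -> u \in T.
Proof.
move=> sT uT; have : [set v in T] == [set: N].
  by rewrite eqEcard subsetT cardsT cardsE (card_uniqP uT) sT leqnn.
by move/eqP/setP/(_ u); rewrite !inE.
Qed.

(** A sequence of singletons has a single ordering, and its wait condition is automatic: distinct
    positions carry distinct nodes, which lie in different singletons. *)
Lemma correct_sequenceP (T : seq N) :
  correct_sequence H1 Ci Cf T <->
  [/\ size T = #|N|, uniq T & forall k, consist [set u in take k T]].
Proof.
split=> [[sT [/andP[uT _] pT _]]|[sT uT cT]].
  split=> // [|k]; first exact: map_uniq uT.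
  apply/consistP; rewrite -upd_seq_conf; apply: (pT T); last exact: prefix_take.
  exact/orderings_seq_set1.
split=> //; split.
- rewrite map_inj_uniq ?uT; last exact: set1_inj.
  by apply: partition_set1 => u; apply: mem_full_uniq.
- move=> U U' /orderings_seq_set1->; rewrite prefixE => /eqP<-.
  by rewrite upd_seq_conf; apply/consistP.
move=> U j l /orderings_seq_set1-> /andP[jl lT] _ S /mapP[t _ ->].
rewrite !in_set1 => -[/eqP jt /eqP lt].
have := nth_uniq H1 (ltn_trans jl lT) lT uT.
by rewrite jt lt eqxx (ltn_eqF jl).
Qed.

Lemma consist_final W : conf W = Cf -> consist W.
Proof. by move=> E q; rewrite /fits E => ->; rewrite implybb orbT. Qed.

(** A node outside [U] has the same outgoing edges in [Ci] and [Cf], so updating it changes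
    nothing. *)
Lemma conf_final U W : conf U = Cf -> U \subset W -> conf W = Cf.
Proof.
move=> E /subsetP UW; apply/setP => e; rewrite inE; case: ifP => // eW.
by rewrite -[in RHS]E inE; case: ifP => // /UW; rewrite eW.
Qed.

Lemma conf_full : conf [set: N] = Cf.
Proof. by apply/setP => e; rewrite !inE. Qed.

Lemma correct_order_final (R : seq N) :
    uniq R -> conf [set u in R] = Cf ->
    (forall k, consist [set u in take k R]) ->
  correct_order H1 Ci Cf R.
Proof.
move=> uR ER cR; split=> //; first by rewrite upd_seq_conf.
move=> V pV; have mV u : (u \in V) = (u \notin R).
  by rewrite (perm_mem pV) mem_enum !inE.
apply/correct_sequenceP; split.
- by rewrite size_cat (perm_size pV) -cardE -(card_uniqP uR) -[#|R|]cardsE cardsC.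
- rewrite cat_uniq uR (perm_uniq pV) enum_uniq andbT.
  by apply/hasPn => u; rewrite mV.
move=> k; rewrite take_cat; case: ifP => // _; apply: consist_final.
by apply: conf_final ER _; apply/subsetP => u; rewrite !inE mem_cat => ->.
Qed.

Lemma correct_order_sequence (R : seq N) :
  correct_order H1 Ci Cf R -> exists T, correct_sequence H1 Ci Cf T.
Proof.
by case=> _ _ H; exists (R ++ enum (~: [set u in R])); apply/H/perm_refl.
Qed.

(** * Executions of the procedure *)

Lemma step_card C V R Rw C' V' R' Rw' :
  step H1 Ci Cf (Running C V R Rw) (Running C' V' R' Rw') -> #|V'| < #|V|.
Proof.
move=> st; inversion_clear st as [| |? ? ? ? s _ sV _].
by rewrite [#|V|](cardsD1 s) sV.
Qed.

(** The number of nodes still to be updated decreases at every pick; the other two states have no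
    successor. *)
Lemma terminatesP : terminates H1 Ci Cf.
Proof.
have halted o : (forall o', ~ step H1 Ci Cf o o') ->
    Acc (fun o' o => step H1 Ci Cf o o') o.
  by move=> H; constructor => o' /H.
suff acc n C V R Rw : #|V| < n ->
    Acc (fun o' o => step H1 Ci Cf o o') (Running C V R Rw) by exact: acc (ltnSn _).
elim: n C V R Rw => [|n IH] C V R Rw; first by rewrite ltn0.
move=> Vn; constructor => o' st.
case: o' st => [C' V' R' Rw'|R' Rw'|] st; last first.
- by apply: halted => o' st'; inversion st'.
- by apply: halted => o' st'; inversion st'.
by apply: IH; apply: leq_trans (step_card st) _.
Qed.

(** The clauses for the two halting states are the correctness claims themselves. A running state
    records consistency of every prefix, as a correct sequence requires. *)
Definition run_invariant (o : state N) : Prop :=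
  match o with
  | Running C V R _ =>
      [/\ C = conf [set u in R], V = ~: [set u in R], uniq R,
          committed [set u in R] & forall k, consist [set u in take k R]]
  | Returned R _ => correct_order H1 Ci Cf R
  | Failed => ~ exists T, correct_sequence H1 Ci Cf T
  end.

Lemma run_invariant_initial : run_invariant (initial_state Ci).
Proof.
have E : [set u in [::]] = set0 :> {set N} by apply/setP => u; rewrite !inE.
rewrite /= E; have [c0 j0] := good0; split=> //; last by rewrite setC0.
by apply/setP => e; rewrite !inE.
Qed.

Lemma run_good C V R Rw :
  run_invariant (Running C V R Rw) -> good [set u in R].
Proof.
by case=> _ _ _ jR cR; split=> //; have := cR (size R); rewrite take_size.
Qed.

(** If the current configuration is not [Cf], some node has not been updated, and [exists_valid]
    applies. This refutes failure when a correct sequence exists. *)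
Lemma run_progress C V R Rw :
    run_invariant (Running C V R Rw) -> C <> Cf ->
    (exists T, correct_sequence H1 Ci Cf T) ->
  exists2 s, s \in V & valid H1 Ci Cf C s.
Proof.
move=> inv CCf [T /correct_sequenceP[sT uT cT]].
have gR := run_good inv; case: inv => EC -> _ _ _.
have [||s sR vs] := exists_valid gR _ uT cT.
- by move=> u; apply: mem_full_uniq.
- by apply: contra_not_neq CCf => ER; rewrite EC ER conf_full.
by exists s; rewrite ?inE ?EC //; move: sR; rewrite inE.
Qed.

Lemma run_invariant_step o o' :
  step H1 Ci Cf o o' -> run_invariant o -> run_invariant o'.
Proof.
case=> [V R Rw [EC _ uR _ cR]|C V R Rw CCf nv inv|C V R Rw s CCf sV vs inv].
- exact: correct_order_final.
- by move=> /(run_progress inv CCf)[s /nv].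
have gR := run_good inv; case: inv => EC EV uR _ cR.
have sR : s \notin R by move: sV; rewrite EV !inE.
have ER : [set u in rcons R s] = s |: [set u in R].
  by apply/setP => u; rewrite !inE mem_rcons inE.
have gR' : good (s |: [set u in R]) by apply: valid_good; rewrite -?EC.
rewrite /= ER rcons_uniq sR EC upd_conf; split=> //; last 1 first.
- move=> k; rewrite -cats1 take_cat; case: ifP => // _.
  (* A prefix at least as long as [R] is either [R] itself or all of [rcons R s]. *)
  case: (k - size R) => [|j]; first by rewrite cats0; apply: gR.1.
  by rewrite /= cats1 ER; apply: gR'.1.
- by rewrite EV setCU setIC setDE.
exact: gR'.2.
Qed.

Lemma reachable_invariant o : reachable H1 Ci Cf o -> run_invariant o.
Proof.
rewrite /reachable => reach; move: run_invariant_initial; elim: reach => //.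
  exact: run_invariant_step.
by move=> o1 o2 o3 _ IH1 _ IH2 /IH1.
Qed.

Lemma running_not_final C V R Rw :
  exists o', step H1 Ci Cf (Running C V R Rw) o'.
Proof.
case: (eqVneq C Cf) => [->|/eqP CCf]; first by exists (Returned R Rw); constructor.
case: (classic (exists2 s, s \in V & valid H1 Ci Cf C s)) => [[s sV vs]|nv].
  by eexists; apply: step_pick vs.
by exists Failed; constructor=> // s sV vs; apply: nv; exists s.
Qed.

Lemma final_outcomeP o : final_outcome H1 Ci Cf o ->
  (exists R Rw, o = Returned R Rw /\ correct_order H1 Ci Cf R) \/
  o = Failed /\ ~ exists T, correct_sequence H1 Ci Cf T.
Proof.
case=> /reachable_invariant; case: o => [C V R Rw|R Rw|] inv fin.
- by have [o' /fin] := running_not_final C V R Rw.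
- by left; exists R, Rw.
by right.
Qed.

End Configurations.

Theorem theorem3 (N : finType) (E : {set N * N}) (H1 : N)
    (Ci Cf : {set N * N})
    (hCi : proper_config E H1 Ci) (hCf : proper_config E H1 Cf) :
  terminates H1 Ci Cf /\
  ((exists T : seq N, correct_sequence H1 Ci Cf T) ->
     forall o, final_outcome H1 Ci Cf o ->
       exists R Rw : seq N, o = Returned R Rw /\ correct_order H1 Ci Cf R) /\
  (~ (exists T : seq N, correct_sequence H1 Ci Cf T) ->
     forall o, final_outcome H1 Ci Cf o -> o = Failed).
Proof.
have [_ _ acCi] := hCi; have [_ _ acCf] := hCf.
split; first exact: terminatesP.
split=> [exT o /(final_outcomeP acCi acCf)[//|[_ /(_ exT)]]//|noT o].
by case/(final_outcomeP acCi acCf) => [[R [Rw [_ /correct_order_sequence/noT]]]|[]].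
Qed.
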